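(* Let $\boldsymbol\alpha\in\mathbb{N}^m$, $\boldsymbol\beta\in\mathbb{N}^n$ with $\sum_i\alpha_i=\sum_j\beta_j=N$, and let $s>0$. Let $A=(a_{ij})$ be a random $m\times n$ matrix whose entries are independent Poisson random variables with rate $s$, i.e. $\Pr[a_{ij}=\ell]=s^\ell e^{-s}/\ell!$ for $\ell\in\{0,1,2,\dots\}$. Let $\mu_{\boldsymbol\alpha,\boldsymbol\beta}$ be the probability that $A$ has row sums $\alpha_1,\dots,\alpha_m$ and column sums $\beta_1,\dots,\beta_n$. Then \[ \frac{(sN)^N}{e^{smn-N}}\prod_{i=1}^m\frac{1}{\alpha_i^{\alpha_i}}\prod_{j=1}^n\frac{1}{\beta_j^{\beta_j}}\ \ge\ \mu_{\boldsymbol\alpha,\boldsymbol\beta}\ \ge\ \frac{(sN)^N}{e^{smn+N}}\prod_{i=1}^m\frac{1}{\alpha_i!}\prod_{j=1}^n\frac{1}{\beta_j!}. \]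
   Context: Convention $0^0=1$. *)

(* Defs.v *)
From HB Require Import structures.
From mathcomp Require Import all_boot all_order all_algebra.
From mathcomp Require Import all_classical all_reals all_analysis.

Set Implicit Arguments.
Unset Strict Implicit.
Unset Printing Implicit Defensive.

Import Order.TTheory GRing.Theory Num.Theory.

Local Open Scope classical_set_scope.
Local Open Scope ring_scope.

(* Mutual (not merely pairwise) independence: the product rule is required for
   every finite subfamily J. *)
Definition independent_RVs (d d' : measure_display) (T : measurableType d)
    (T' : measurableType d') (R : realType) (P : probability T R)
    (I : finType) (X : I -> {RV P >-> T'}) : Prop :=
  forall (J : {set I}) (B : I -> set T'),
    (forall i, measurable (B i)) ->
    P [set t | forall i, i \in J -> B i (X i t)] =
      (\prod_(i in J) P (X i @^-1` B i))%E.

Definition has_margins (m n : nat) (a : 'I_m -> 'I_n -> nat)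
    (alpha : 'I_m -> nat) (beta : 'I_n -> nat) : Prop :=
  (forall i, (\sum_(j < n) a i j)%N = alpha i) /\
  (forall j, (\sum_(i < m) a i j)%N = beta j).

Definition margin_probability (d : measure_display) (T : measurableType d)
    (R : realType) (P : probability T R) (m n : nat)
    (A : 'I_m -> 'I_n -> {RV P >-> nat})
    (alpha : 'I_m -> nat) (beta : 'I_n -> nat) : \bar R :=
  P [set t | has_margins (fun i j => A i j t) alpha beta].

(* Main.v *)
(** The margin probability has a closed form: by independence it equals
    [s^N e^(-smn)] times the sum, over nonnegative integer matrices with the
    prescribed margins, of [prod_ij 1/a_ij!], and that sum is
    [N! / (prod_i alpha_i! prod_j beta_j!)].  The latter follows by removing
    one column at a time and applying the multi-set Vandermonde identity.

    Put [g k = k^k / k!].  The lower bound is then [g N <= e^N], and the upper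
    bound is [prod_i g (alpha_i) * prod_j g (beta_j) <= e^N * g N]: the first
    product is at most [e^N] factor by factor, and the second is at most [g N]
    because [g a * g b <= g (a + b)], which compares a single term of the
    binomial expansion of [(a + b)^(a + b)] with the whole sum. *)

Require Import Defs.
From HB Require Import structures.
From mathcomp Require Import all_boot all_order all_algebra.
From mathcomp Require Import all_classical all_reals all_analysis.
From mathcomp Require Import ring.

Set Implicit Arguments.
Unset Strict Implicit.
Unset Printing Implicit Defensive.

Import Order.TTheory GRing.Theory Num.Theory.

Local Open Scope classical_set_scope.
Local Open Scope ring_scope.

(** * Multi-set Vandermonde identity *)

(** The added terms have zero binomials. A range independent of [a] lets a product of such sums be
    expanded over functions into one finite type. *)
Lemma exprD1n_widen (R : comNzSemiRingType) (x : R) (a K : nat) :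
  (a <= K)%N -> (x + 1) ^+ a = \sum_(c < K.+1) 'C(a, c)%:R * x ^+ c.
Proof.
move=> aK; rewrite exprD1n -(big_mkord xpredT (fun c => x ^+ c *+ 'C(a, c))).
rewrite -(big_mkord xpredT (fun c => 'C(a, c)%:R * x ^+ c)).
rewrite (@big_cat_nat _ _ _ a.+1 0 K.+1) //= [X in _ = _ + X]big_nat_cond [X in _ + X]big1 ?addr0.
  by apply: eq_bigr => c _; rewrite mulr_natl.
by move=> c /andP[/andP[ac _] _]; rewrite bin_small // mul0r.
Qed.

Lemma Vandermonde_ffun (R : comNzRingType) (I : finType) (K b : nat)
    (a : I -> nat) : (forall i, a i <= K)%N ->
  \sum_(c : {ffun I -> 'I_K.+1} | (\sum_i c i == b)%N)
     \prod_i 'C(a i, c i)%:R = 'C(\sum_i a i, b)%:R :> R.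
Proof.
move=> aK; set N := (\sum_i a i)%N.
(* Both sides are the coefficient of X^b in prod_i (X + 1)^(a i). *)
have coefXD1 : (('X + 1 : {poly R}) ^+ N)`_b = 'C(N, b)%:R.
  rewrite (@exprD1n_widen _ _ _ (maxn N b)) ?leq_maxl // coef_sum.
  have bm : (b < (maxn N b).+1)%N by rewrite ltnS leq_maxr.
  rewrite (bigD1 (Ordinal bm)) //= big1 ?addr0.
    by rewrite mulr_natl coefMn coefXn eqxx.
  move=> c /negPf cb; rewrite mulr_natl coefMn coefXn.
  by rewrite -(inj_eq val_inj) /= in cb; rewrite eq_sym cb mul0rn.
rewrite -coefXD1 /N -prodrXr.
under eq_bigr do rewrite (exprD1n_widen _ (aK _)).
rewrite bigA_distr_bigA coef_sum big_mkcond /=; apply: eq_bigr => c _.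
rewrite big_split /= -!natr_prod prodrXr mulr_natl coefMn coefXn eq_sym.
by case: eqP => _; rewrite ?mul0rn.
Qed.

Lemma sum_ffun_ord_recl (R : nmodType) (T : finType) (n : nat)
    (F : {ffun 'I_n.+1 -> T} -> R) :
  \sum_f F f = \sum_c \sum_(g : {ffun 'I_n -> T})
     F [ffun i => if unlift ord0 i is Some j then g j else c].
Proof.
rewrite pair_bigA /=.
rewrite (reindex (fun p : T * {ffun 'I_n -> T} =>
  [ffun i => if unlift ord0 i is Some j then p.2 j else p.1])) //=.
exists (fun f : {ffun 'I_n.+1 -> T} => (f ord0, [ffun j => f (lift ord0 j)])).
  move=> [c g] _ /=; congr pair; first by rewrite ffunE unlift_none.
  by apply/ffunP => j; rewrite !ffunE liftK.
move=> f _ /=; apply/ffunP => i; rewrite ffunE.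
by case: unliftP => [j ->|->]; rewrite ?ffunE.
Qed.

(** * Inequalities for [k^k / k!] *)

Lemma expr_ratio_fact_superadd (R : numFieldType) (a b : nat) :
  (a%:R ^+ a / a`!%:R) * (b%:R ^+ b / b`!%:R)
    <= (a + b)%:R ^+ (a + b) / (a + b)`!%:R :> R.
Proof.
have fgt0 k : 0 < k`!%:R :> R by rewrite ltr0n fact_gt0.
rewrite mulf_div ler_pdivlMr // mulrAC ler_pdivrMr ?mulr_gt0 //.
rewrite -(bin_fact (leq_addl a b)) addnK -!natrX -!natrM ler_nat expnDn.
(* Cancelling [b! * a!] leaves [a^a * b^b * 'C(a + b, b)], the term of index [b] in the expansion of
   [(a + b)^(a + b)]. *)
rewrite [(a`! * _)%N]mulnC mulnA leq_mul2r; apply/orP; right.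
have bab : (b < (a + b).+1)%N by rewrite ltnS leq_addl.
by rewrite (bigD1 (Ordinal bab)) //= addnK mulnC leq_addr.
Qed.

Lemma prod_expr_ratio_fact_le (R : numFieldType) (I : finType) (a : I -> nat) :
  \prod_i ((a i)%:R ^+ a i / (a i)`!%:R)
    <= (\sum_i a i)%:R ^+ (\sum_i a i)%N / (\sum_i a i)`!%:R :> R.
Proof.
(* Product and sum grow together; the empty case relies on [0^0 = 1]. *)
apply: (big_rec2 (fun (x : R) k => x <= k%:R ^+ k / k`!%:R)).
  by rewrite expr0 fact0 divr1.
move=> i x k _ xk; apply: le_trans (expr_ratio_fact_superadd R (a i) k).
by apply: ler_wpM2l => //; rewrite divr_ge0 ?exprn_ge0.
Qed.

(** The left side is the degree [a] term of the exponential series at [a]. *)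
Lemma expr_ratio_fact_le_expR (R : realType) (a : nat) :
  a%:R ^+ a / a`!%:R <= expR a%:R :> R.
Proof.
case: a => [|a]; first by rewrite expr0 fact0 divr1 expR0.
by apply: le_trans (expR_ge1Dxn a _) => //; rewrite lerDr.
Qed.

(** * Weighted sum over matrices with given margins *)

Lemma inv_factM_inv_fact (R : numFieldType) (a c : nat) : (c <= a)%N ->
  c`!%:R^-1 * (a - c)`!%:R^-1 = 'C(a, c)%:R / a`!%:R :> R.
Proof.
move=> ca; have f0 k : k`!%:R != 0 :> R by rewrite pnatr_eq0 -lt0n fact_gt0.
have C0 : 'C(a, c)%:R != 0 :> R by rewrite pnatr_eq0 -lt0n bin_gt0.
rewrite -(bin_fact ca) !natrM; field.
by rewrite !f0 C0.
Qed.

(* Matrices are stored column-wise: [G j i] is the entry in row i, column j;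
   [K] is any bound on the row sums, making the set of matrices finite. *)
Definition margins_eq (m n K : nat) (alpha : 'I_m -> nat) (beta : 'I_n -> nat)
    (G : {ffun 'I_n -> {ffun 'I_m -> 'I_K.+1}}) : bool :=
  [forall j, \sum_i G j i == beta j]%N && [forall i, \sum_j G j i == alpha i]%N.

(** Removing the first column [c] lowers the row sums by [c]. The condition [c i <= alpha i] keeps
    the truncated subtraction exact. *)
Lemma margins_eq_recl (m n K : nat) (alpha : 'I_m -> nat)
    (beta : 'I_n.+1 -> nat) (c : {ffun 'I_m -> 'I_K.+1})
    (g : {ffun 'I_n -> {ffun 'I_m -> 'I_K.+1}}) :
  margins_eq alpha beta
    [ffun i => if unlift ord0 i is Some j then g j else c] =
  [&& \sum_i c i == beta ord0, [forall i, c i <= alpha i] &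
    margins_eq (fun i => alpha i - c i) (fun j => beta (lift ord0 j)) g]%N.
Proof.
apply/idP/idP.
- move=> /andP[/forallP col /forallP row].
  have rowE i : (alpha i = c i + \sum_j g j i)%N.
    rewrite -(eqP (row i)) big_ord_recl ffunE unlift_none; congr addn.
    by apply: eq_bigr => j _; rewrite ffunE liftK.
  apply/and3P; split.
  + by rewrite -(eqP (col ord0)) ffunE unlift_none.
  + by apply/forallP => i; rewrite rowE leq_addr.
  + apply/andP; split; apply/forallP => i; last by rewrite rowE addKn.
    by rewrite -(eqP (col (lift ord0 i))) ffunE liftK.
- move=> /and3P[/eqP c0 /forallP ca /andP[/forallP col /forallP row]].
  apply/andP; split; apply/forallP => i.
    by rewrite ffunE; case: unliftP => [j ->|->]; rewrite ?c0.
  rewrite big_ord_recl ffunE unlift_none.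
  rewrite -[X in _ == X](subnKC (ca i)) eqn_add2l -(eqP (row i)); apply/eqP.
  by apply: eq_bigr => j _; rewrite ffunE liftK.
Qed.

Lemma sum_margins_eq (R : numFieldType) (m n K : nat)
    (alpha : 'I_m -> nat) (beta : 'I_n -> nat) :
  (forall i, alpha i <= K)%N -> (\sum_i alpha i = \sum_j beta j)%N ->
  \sum_(G : {ffun 'I_n -> {ffun 'I_m -> 'I_K.+1}} | margins_eq alpha beta G)
     \prod_j \prod_i (G j i)`!%:R^-1 =
  (\sum_i alpha i)`!%:R / (\prod_i (alpha i)`!%:R * \prod_j (beta j)`!%:R) :> R.
Proof.
have f0 k : k`!%:R != 0 :> R by rewrite pnatr_eq0 -lt0n fact_gt0.
(* The row sums change with each removed column, so they are generalized; [K] still bounds them.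
   Without columns, the empty matrix is the only one and all row sums vanish. *)
elim: n alpha beta => [|n IHn] alpha beta aK sab.
  have a0 i : alpha i = 0%N.
    by apply/eqP; move/eqP: sab; rewrite big_ord0 sum_nat_eq0 => /forallP/(_ i).
  rewrite (big_pred1 [ffun=> [ffun=> ord0]]) => [|G]; last first.
    rewrite /margins_eq.
    have -> : G = [ffun=> [ffun=> ord0]] by apply/ffunP => -[].
    rewrite /= eqxx; apply/andP; split; apply/forallP => i; first by case: i.
    by rewrite big_ord0 a0.
  rewrite sab !big_ord0 big1 ?mulr1 ?divr1 ?fact0 // => i _.
  by rewrite a0 fact0.
set b' := fun j : 'I_n => beta (lift ord0 j).
have sumN : (\sum_i alpha i = beta ord0 + \sum_j b' j)%N.
  by rewrite sab big_ord_recl.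
(* [D] is the part independent of [c]: each [1 / (c i)! (alpha i - c i)!] becomes
   ['C(alpha i, c i) / (alpha i)!], and Vandermonde sums the binomials. *)
pose D : R := (\sum_j b' j)`!%:R /
  (\prod_i (alpha i)`!%:R * \prod_j (b' j)`!%:R).
rewrite big_mkcond sum_ffun_ord_recl.
transitivity (\sum_(c : {ffun 'I_m -> 'I_K.+1} | (\sum_i c i == beta ord0)%N)
    \prod_i 'C(alpha i, c i)%:R * D); last first.
  rewrite -mulr_suml Vandermonde_ffun // sumN /D big_ord_recl.
  rewrite -(bin_fact (leq_addr (\sum_j b' j) (beta ord0))) addKn !natrM.
  have pa : \prod_i (alpha i)`!%:R != 0 :> R by apply/prodf_neq0.
  have pb : \prod_j (b' j)`!%:R != 0 :> R by apply/prodf_neq0.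
  rewrite -/b'; field.
  by rewrite f0 pa pb.
rewrite [RHS]big_mkcond; apply: eq_bigr => c _.
under [LHS]eq_bigr => g _ do rewrite margins_eq_recl big_ord_recl ffunE unlift_none.
case: eqP => /= [c0|_]; last by rewrite big1.
(* If [c] exceeds a row sum, no completion exists on the left and a binomial vanishes on the
   right. *)
have [/forallP ca|nca] := boolP [forall i, c i <= alpha i]%N => /=; last first.
  rewrite big1 //; move: nca; rewrite negb_forall => /existsP[i].
  by rewrite -ltnNge => lt_a_c; rewrite (bigD1 i) //= bin_small // !mul0r.
rewrite -big_mkcond -mulr_sumr /=.
rewrite (eq_bigr (fun g : {ffun 'I_n -> {ffun 'I_m -> 'I_K.+1}} =>
    \prod_j \prod_i (g j i)`!%:R^-1)) => [|g _]; last first.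
  by apply: eq_bigr => j _; rewrite ffunE liftK.
have sab' : (\sum_i (alpha i - c i) = \sum_j b' j)%N.
  by rewrite sumnB // c0 sumN addKn.
rewrite IHn // => [|i]; last exact: leq_trans (leq_subr _ _) (aK i).
rewrite sab' /D !invfM mulrCA [RHS]mulrCA !mulrA -!prodfV.
rewrite -!mulrA; congr (_ * _); rewrite !mulrA; congr (_ * _).
rewrite -!big_split /=.
by apply: eq_bigr => i _; rewrite inv_factM_inv_fact.
Qed.

(** * Probability of the margins and its bounds *)

Lemma prob_margins (R : realType) (m n K : nat)
    (alpha : 'I_m -> nat) (beta : 'I_n -> nat)
    (d : measure_display) (T : measurableType d) (P : probability T R)
    (A : 'I_m -> 'I_n -> {RV P >-> nat}) (p : nat -> R) :
  (forall i, alpha i <= K)%N ->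
  independent_RVs (fun ij : 'I_m * 'I_n => A ij.1 ij.2) ->
  (forall i j l, P [set t | A i j t = l] = (p l)%:E) ->
  margin_probability A alpha beta =
  (\sum_(G : {ffun 'I_n -> {ffun 'I_m -> 'I_K.+1}} | margins_eq alpha beta G)
     \prod_j \prod_i p (G j i))%:E.
Proof.
move=> aK Aind Ap.
(* [E G] is the event that [A] equals [G], phrased to match the independence hypothesis for the full
   index set. These events partition the margin event. *)
pose E (G : {ffun 'I_n -> {ffun 'I_m -> 'I_K.+1}}) : set T :=
  [set t | forall ij, ij \in [set: 'I_m * 'I_n]%SET ->
     [set (G ij.2 ij.1 : nat)] (A ij.1 ij.2 t)].
have PE G : P (E G) = (\prod_j \prod_i p (G j i))%:E.
  rewrite /E (Aind [set: _]%SET (fun ij => [set (G ij.2 ij.1 : nat)])) //.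
  rewrite (eq_bigr (fun ij => (p (G ij.2 ij.1))%:E)) => [|ij _].
    rewrite prodEFin exchange_big pair_big /=; congr EFin.
    by apply: eq_bigl => ij; rewrite inE.
  exact: Ap.
have EU : [set t | has_margins (fun i j => A i j t) alpha beta] =
    \bigcup_(G in [set` margins_eq alpha beta]) E G.
  apply/seteqP; split => t /=.
    move=> [row col].
    (* An entry is at most its row sum, so the sampled matrix lies in the finite type. *)
    have AK i j : (A i j t < K.+1)%N.
      by rewrite ltnS (leq_trans _ (aK i)) // -row (bigD1 j) //= leq_addr.
    exists [ffun j => [ffun i => Ordinal (AK i j)]].
      apply/andP; split; apply/forallP => i; apply/eqP.
        by rewrite -col; apply: eq_bigr => j _; rewrite !ffunE.
      by rewrite -row; apply: eq_bigr => j _; rewrite !ffunE.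
    by move=> [i j] _ /=; rewrite !ffunE.
  move=> [G /andP[/forallP col /forallP row] EG].
  split=> i.
    by rewrite -(eqP (row i)); apply: eq_bigr => j _; rewrite (EG (i, j)) ?inE.
  by rewrite -(eqP (col i)); apply: eq_bigr => j _; rewrite (EG (j, i)) ?inE.
have mE G : measurable (E G).
  rewrite (_ : E G = \bigcap_(ij in [set: 'I_m * 'I_n])
      (A ij.1 ij.2 @^-1` [set (G ij.2 ij.1 : nat)])).
    apply: fin_bigcap_measurable => // ij _; exact: measurable_funPTI.
  by apply/seteqP; split=> t Gt ij ?; apply: Gt; rewrite ?inE.
have tE : trivIset [set` margins_eq alpha beta] E.
  move=> G H _ _ [t [Gt Ht]]; apply/ffunP => j; apply/ffunP => i.
  apply: val_inj => /=.
  by have := Gt (i, j); have := Ht (i, j); rewrite inE /= => <- // <-.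
rewrite /margin_probability EU measure_fin_bigcup //.
rewrite -(@bigfs _ _ _ _ (index_enum _) (margins_eq alpha beta)) ?index_enum_uniq //.
  by rewrite -sumEFin; apply: eq_bigr => G _; exact: PE.
by move=> G _; rewrite mem_index_enum.
Qed.

Lemma poisson_prob_margins (R : realType) (m n N : nat)
    (alpha : 'I_m -> nat) (beta : 'I_n -> nat) (s : R)
    (d : measure_display) (T : measurableType d) (P : probability T R)
    (A : 'I_m -> 'I_n -> {RV P >-> nat}) :
  (\sum_i alpha i)%N = N -> (\sum_j beta j)%N = N ->
  independent_RVs (fun ij : 'I_m * 'I_n => A ij.1 ij.2) ->
  (forall i j l,
    P [set t | A i j t = l] = (s ^+ l * expR (- s) / l`!%:R)%:E) ->
  margin_probability A alpha beta =
  (s ^+ N * expR (- (s * m%:R * n%:R)) *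
    (N`!%:R / (\prod_i (alpha i)`!%:R * \prod_j (beta j)`!%:R)))%:E.
Proof.
move=> sa sb Aind Ap.
have aN i : (alpha i <= N)%N by rewrite -sa (bigD1 i) //= leq_addr.
rewrite (prob_margins beta aN Aind Ap) -[in N`!]sa; congr EFin.
rewrite -(sum_margins_eq R aN) ?sa ?sb // mulr_sumr.
apply: eq_bigr => G /andP[/forallP col _].
(* Powers of [s] are distributed first over columns, then over entries, as the column sums add up to
   [N]. *)
rewrite -[X in s ^+ X * _]sb -prodrXr.
have -> : expR (- (s * m%:R * n%:R)) = \prod_(j < n) \prod_(i < m) expR (- s).
  rewrite !prodr_const !card_ord -!expRM_natr; congr expR; ring.
rewrite -!big_split; apply: eq_bigr => j _ /=.
rewrite -(eqP (col j)) -prodrXr -!big_split /=.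
by apply: eq_bigr => i _.
Qed.

Theorem theorem3p3 (R : realType) (m n N : nat)
    (alpha : 'I_m -> nat) (beta : 'I_n -> nat)
    (sum_alpha : (\sum_(i < m) alpha i)%N = N)
    (sum_beta : (\sum_(j < n) beta j)%N = N)
    (s : R) (s_gt0 : 0 < s)
    (d : measure_display) (T : measurableType d) (P : probability T R)
    (A : 'I_m -> 'I_n -> {RV P >-> nat})
    (A_indep : independent_RVs (fun ij : 'I_m * 'I_n => A ij.1 ij.2))
    (A_poisson : forall (i : 'I_m) (j : 'I_n) (l : nat),
      P [set t | A i j t = l] = (s ^+ l * expR (- s) / l`!%:R)%:E) :
  (((s * N%:R) ^+ N / expR (s * m%:R * n%:R - N%:R)
      * \prod_(i < m) (1 / (alpha i)%:R ^+ alpha i)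
      * \prod_(j < n) (1 / (beta j)%:R ^+ beta j))%:E
     >= margin_probability A alpha beta)%E /\
  (margin_probability A alpha beta
     >= ((s * N%:R) ^+ N / expR (s * m%:R * n%:R + N%:R)
      * \prod_(i < m) (1 / (alpha i)`!%:R)
      * \prod_(j < n) (1 / (beta j)`!%:R))%:E)%E.
Proof.
rewrite (poisson_prob_margins sum_alpha sum_beta A_indep A_poisson) !lee_fin.
pose g k : R := k%:R ^+ k / k`!%:R.
have f0 k : 0 < k`!%:R :> R by rewrite ltr0n fact_gt0.
have g0 k : 0 <= g k by rewrite divr_ge0 ?exprn_ge0.
have k0 k : 0 < k%:R ^+ k :> R.
  by case: k => [|k]; rewrite ?expr0 // exprn_gt0 ?ltr0n.
have C0 : 0 <= s ^+ N * expR (- (s * m%:R * n%:R)).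
  by rewrite mulr_ge0 ?expR_ge0 ?exprn_ge0 ?ltW.
set C := s ^+ N * _ in C0 *.
have invE (h : nat -> R) p (f : 'I_p -> nat) :
  \prod_i (1 / h (f i)) = (\prod_i h (f i))^-1.
  by rewrite -prodfV; apply: eq_bigr => i _; rewrite div1r.
rewrite (invE (fun k => k%:R ^+ k) m) (invE (fun k => k%:R ^+ k) n).
rewrite (invE (fun k => k`!%:R) m) (invE (fun k => k`!%:R) n).
set Pa := \prod_(i < m) (alpha i)`!%:R; set Pb := \prod_(j < n) (beta j)`!%:R.
set Qa := \prod_(i < m) (alpha i)%:R ^+ alpha i.
set Qb := \prod_(j < n) (beta j)%:R ^+ beta j.
have Pa0 : 0 < Pa by apply: prodr_gt0.
have Pb0 : 0 < Pb by apply: prodr_gt0.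
have Qa0 : 0 < Qa by apply: prodr_gt0.
have Qb0 : 0 < Qb by apply: prodr_gt0.
rewrite exprMn -!expRN opprB opprD expRD [expR (_ - N%:R)]expRD.
split.
- have ga : Qa / Pa <= expR N%:R.
    rewrite -prodf_div -sum_alpha natr_sum expR_sum; apply: ler_prod => i _.
    by rewrite g0 expr_ratio_fact_le_expR.
  have gb : Qb / Pb <= g N.
    by rewrite -prodf_div /g -sum_beta prod_expr_ratio_fact_le.
  (* Factoring both sides by [C * N! / (Qa * Qb)] leaves the comparison of [ga] times [gb]. *)
  have -> : s ^+ N * N%:R ^+ N * (expR N%:R * expR (- (s * m%:R * n%:R)))
      / Qa / Qb = C * (N`!%:R / (Qa * Qb) * (expR N%:R * g N)).
    by rewrite /C /g; field; rewrite !gt_eqF.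
  have -> : N`!%:R / (Pa * Pb) = N`!%:R / (Qa * Qb) * (Qa / Pa * (Qb / Pb)).
    by field; rewrite !gt_eqF.
  apply: ler_wpM2l => //; apply: ler_wpM2l; first by rewrite divr_ge0 ?mulr_ge0 ?ltW.
  by apply: ler_pM => //; rewrite divr_ge0 ?ltW.
- have gN := expr_ratio_fact_le_expR R N.
  (* With [C / (Pa * Pb)] factored out, [N^N * e^(-N) <= N!] remains, which is [gN]. *)
  have -> : s ^+ N * N%:R ^+ N * (expR (- (s * m%:R * n%:R)) * expR (- N%:R))
      / Pa / Pb = C * (N%:R ^+ N * expR (- N%:R) / (Pa * Pb)).
    by rewrite /C; field; rewrite !gt_eqF.
  apply: ler_wpM2l => //; apply: ler_wpM2r; first by rewrite invr_ge0 mulr_ge0 ?ltW.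
  by rewrite expRN ler_pdivrMr ?expR_gt0 // mulrC -ler_pdivrMr.
Qed.
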